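(* Let $G$ be a finite group, $F$ a field of characteristic $p$ and $V$ a $G$-module over $F$. Write $A=F[V]=F[x_1,\ldots,x_n]$ and $I_A=A^G_+A$. Assume that there exist integers $a_1,\dots,a_n$, strictly smaller than $p$ in case of positive characteristic, such that $L(I_A)=(x_1^{a_1},\dots,x_n^{a_n})$. Then \[ \operatorname{topdeg} F[V^{m}]_G=\operatorname{topdeg} F[V]_G=\sum_{i=1}^{n}(a_{i}-1)\quad\text{ for all positive integers } m. \]
   Context: A $G$-module is a finite-dimensional representation $V$ of the finite group $G$ over the field $F$; $V^m$ denotes the $m$-fold direct sum of $V$. $F[V]=S(V^* )$ is the symmetric algebra on the dual space, graded by degree, on which $G$ acts by $\sigma(f)=f\circ\sigma^{-1}$; $x_1,\ldots,x_n$ is a basis of $V^*$, so $F[V]=F[x_1,\dots,x_n]$. $F[V]^G$ is the ring of invariants and $F[V]^G_+$ is the set of invariants with zero constant term. The Hilbert ideal is the ideal $F[V]^G_+F[V]$ of $F[V]$, and the algebra of coinvariants is the finite-dimensional graded algebra $F[V]_G=F[V]/F[V]^G_+F[V]$. Its top degree $\operatorname{topdeg}F[V]_G$ is the largest degree in which $F[V]_G$ is non-zero. The ring $A=F[x_1,\dots,x_n]$ carries the lexicographic monomial order with $x_1>x_2>\cdots>x_n$, and for an ideal $I$ of $A$, $L(I)$ denotes its lead term ideal, i.e. the ideal generated by the lead terms of the non-zero elements of $I$. The $x_i^{a_i}$ are monomials of $A$, so the exponents $a_i$ are non-negative. *)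

(* Defs.v *)
From HB Require Import structures.
From mathcomp Require Import all_boot all_order all_fingroup all_algebra.
From mathcomp Require Import ring_quotient mxrepresentation character.
From mathcomp Require Import mpoly boolp.

Set Implicit Arguments.
Unset Strict Implicit.
Unset Printing Implicit Defensive.

Import Order.TTheory GRing.Theory.
Local Open Scope ring_scope.
Local Open Scope quotient_scope.

Section GeneratedIdeal.
Variable A : comNzRingType.
Implicit Types (S : {pred A}) (f : A).

Definition gen_ideal S : {pred A} := fun f =>
  `[< exists s : seq (A * A),
      {in s, forall u, u.2 \in S} /\ f = \sum_(u <- s) u.1 * u.2 >].

Lemma gen_idealP S f :
  reflect (exists s : seq (A * A),
             {in s, forall u, u.2 \in S} /\ f = \sum_(u <- s) u.1 * u.2)
          (f \in gen_ideal S).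
Proof. exact: asboolP. Qed.

Lemma gen_ideal0 S : 0 \in gen_ideal S.
Proof. by apply/gen_idealP; exists [::]; rewrite big_nil. Qed.

Lemma gen_idealD S : {in gen_ideal S &, forall f g, f + g \in gen_ideal S}.
Proof.
move=> f g /gen_idealP[s [sS ->]] /gen_idealP[t [tS ->]].
apply/gen_idealP; exists (s ++ t); rewrite big_cat; split=> // u.
by rewrite mem_cat => /orP[/sS | /tS].
Qed.

Lemma gen_idealMl S f : {in gen_ideal S, forall g, f * g \in gen_ideal S}.
Proof.
move=> g /gen_idealP[s [sS ->]]; apply/gen_idealP.
exists [seq (f * u.1, u.2) | u <- s]; split=> [_ /mapP[u us ->]|].
  exact: sS us.
by rewrite big_map big_distrr; apply: eq_bigr => u _; rewrite /= mulrA.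
Qed.

Lemma mem_gen_ideal S : {subset S <= gen_ideal S}.
Proof.
move=> f fS; apply/gen_idealP; exists [:: (1, f)]; rewrite big_seq1 mul1r.
by split=> // u; rewrite inE => /eqP->.
Qed.

Lemma gen_ideal_sum S I (r : seq I) (P : pred I) (h : I -> A) :
  (forall i, P i -> h i \in gen_ideal S) ->
  \sum_(i <- r | P i) h i \in gen_ideal S.
Proof.
move=> hS; elim/big_ind: _ => //; [exact: gen_ideal0 | exact: gen_idealD].
Qed.

End GeneratedIdeal.

Section LexLeadTerm.
Variables (n : nat) (F : fieldType).
Implicit Types (f : {mpoly F[n]}) (I : {pred {mpoly F[n]}}).

(* The order on monomials carried by 'X_{1..n} is graded, so the maximum is
   taken in n.-tuplelexi nat instead: the exponent of 'X_0 is compared first,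
   hence 'X_0 > 'X_1 > ... *)
Definition lexlead f : 'X_{1..n} :=
  Multinom (\join_(m <- msupp f) (multinom_val m : n.-tuplelexi nat))%O.

Definition lead_term f : {mpoly F[n]} := f@_(lexlead f) *: 'X_[lexlead f].

Definition lead_term_ideal I : {pred {mpoly F[n]}} :=
  gen_ideal (fun t => `[< exists f, [/\ f \in I, f != 0 & t = lead_term f] >]).

Definition pure_power_ideal (a : 'I_n -> nat) : {pred {mpoly F[n]}} :=
  gen_ideal [pred t | [exists i, t == 'X_i ^+ a i]].

End LexLeadTerm.

Lemma orbit_integral (R K : comNzRingType) (gT : finGroupType) (G : {group gT})
    (act : gT -> {rmorphism R -> R}) (e : {rmorphism R -> K}) (x : R)
    (actM : forall g h f, g \in G -> h \in G ->
       act g (act h f) = act (g * h)%g f)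
    (act1 : act 1%g x = x) (ex0 : forall g, e (act g x) = 0) :
  exists c : nat -> R,
    [/\ forall k g, g \in G -> act g (c k) = c k,
        forall k, (k < #|G|)%N -> e (c k) = 0
      & x ^+ #|G| = \sum_(k < #|G|) c k * x ^+ k].
Proof.
pose P : {poly R} := \prod_(g in G) ('X - (act g x)%:P).
have szP : size P = #|G|.+1 by rewrite /P -big_enum size_prod_XsubC -cardE.
have leadP : P`_#|G| = 1.
  have /monicP : P \is monic by apply: monic_prod_XsubC.
  by rewrite lead_coefE szP.
have rootP : P.[x] = 0.
  rewrite /P (bigD1 1%g) ?group1 //= act1.
  by rewrite hornerM hornerXsubC subrr mul0r.
exists (fun k => - P`_k); split=> [k h hG | k kG |].
- rewrite rmorphN -coef_map; congr (- _`_k).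
  rewrite /P rmorph_prod (reindex_inj (mulgI h^-1%g)) /=.
  rewrite (eq_bigl (mem G)) => [|g]; last by rewrite groupMl ?groupV.
  rewrite (eq_bigr (fun g => 'X - (act g x)%:P)) // => g gG.
  by rewrite rmorphB /= map_polyX map_polyC /= actM ?groupM ?groupV // mulKVg.
- rewrite rmorphN -coef_map /P rmorph_prod /=.
  rewrite (eq_bigr (fun=> 'X)) => [|g _]; last first.
    by rewrite rmorphB /= map_polyX map_polyC /= ex0 subr0.
  by rewrite prodr_const coefXn (ltn_eqF kG) oppr0.
move/eqP: rootP; rewrite horner_coef szP big_ord_recr /= leadP mul1r addrC.
by rewrite addr_eq0 -sumrN => /eqP->; apply: eq_bigr => k _; rewrite mulNr.
Qed.

Section Coinvariants.
Variables (F : fieldType) (gT : finGroupType) (G : {group gT}).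
Variable V : representation F G.
Local Notation n := (rdegree V).
Local Notation A := {mpoly F[n]}.
Implicit Types (g h : gT) (f : A).

(* V is the space of column vectors, on which g acts by v |-> V g *m v, and
   the 'X_i are the coordinate functions: g sends f to f \o (V g^-1 *m _). *)
Definition poly_act g f : A :=
  f \mPo [tuple \sum_(j < n) V g^-1%g i j *: 'X_j | i < n].

Definition invariant : {pred A} :=
  [pred f | [forall g in G, poly_act g f == f]].

Definition invariant_pos : {pred A} :=
  [pred f | (f \in invariant) && (f@_0%MM == 0)].

Definition hilbert_ideal : {pred A} := gen_ideal invariant_pos.

Lemma hilbert_ideal_closed : idealr_closed hilbert_ideal.
Proof.
split=> [||f g h gI hI]; first exact: gen_ideal0; last first.
  by apply: gen_idealD => //; apply: gen_idealMl.
apply/negP => /gen_idealP[s [sS /(congr1 (mcoeff 0%MM))/eqP]].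
rewrite rmorph1 rmorph_sum /= big_seq big1 ?oner_eq0 // => u us.
by rewrite rmorphM /=; have /andP[_ /eqP->] := sS u us; rewrite mulr0.
Qed.

HB.instance Definition _ := isIdealr.Build A hilbert_ideal hilbert_ideal_closed.

Definition coinvariants := {ideal_quot hilbert_ideal}.

Definition coinvariants_deg_neq0 : pred nat := fun d =>
  `[< exists2 f : A, f \is d.-homog & \pi_coinvariants f != 0 >].

Lemma pi_coinvariants_eq0 f :
  (\pi_coinvariants f == 0) = (f \in hilbert_ideal).
Proof.
by rewrite -[RHS]/(f \in (hilbert_ideal : pred A)) -[f in RHS]subr0
           Quotient.idealrBE pi_zeror.
Qed.

Lemma poly_act_mul g h f : g \in G -> h \in G ->
  poly_act g (poly_act h f) = poly_act (g * h)%g f.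
Proof.
move=> gG hG.
rewrite /poly_act [f \mPo _]comp_mpolyEX raddf_sum [RHS]comp_mpolyEX /=.
apply: eq_bigr => m _; rewrite comp_mpolyZ; congr (_ *: _).
rewrite !comp_mpolyX rmorph_prod; apply: eq_bigr => i _ /=.
rewrite rmorphXn /= !tnth_mktuple; congr (_ ^+ _).
rewrite raddf_sum /= invMg repr_mxM ?groupV //.
under eq_bigr => j _ do rewrite comp_mpolyZ comp_mpolyXU -tnth_nth tnth_mktuple
  scaler_sumr.
rewrite exchange_big; apply: eq_bigr => k _; rewrite mxE scaler_suml.
by apply: eq_bigr => j _; rewrite scalerA.
Qed.

Lemma poly_act1 f : poly_act 1 f = f.
Proof.
rewrite -[RHS]comp_mpoly_id /poly_act; congr (_ \mPo _).
apply: eq_from_tnth => i; rewrite !tnth_mktuple invg1 repr_mx1.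
rewrite (bigD1 i) //= big1 ?mxE ?eqxx ?scale1r ?addr0 // => j ji.
by rewrite mxE eq_sym (negbTE ji) scale0r.
Qed.

HB.instance Definition _ g :=
  GRing.RMorphism.copy (poly_act g)
    (comp_mpoly [tuple \sum_(j < n) V g^-1%g i j *: 'X_j | i < n]).

Lemma exp_var_hilbert_ideal i : ('X_i : A) ^+ #|G| \in hilbert_ideal.
Proof.
have ct_var g : (poly_act g 'X_i)@_0%MM = 0.
  rewrite /poly_act comp_mpolyXU -tnth_nth tnth_mktuple raddf_sum.
  by rewrite big1 // => j _; rewrite /= mcoeffZ mcoeffX mnm1_eq0 mulr0.
have [c [cG c0 ->]] := @orbit_integral A F gT G poly_act (mcoeff 0%MM) 'X_i
  poly_act_mul (poly_act1 _) ct_var.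
apply: gen_ideal_sum => k _; rewrite mulrC.
apply/gen_idealMl/mem_gen_ideal; rewrite !inE c0 ?ltn_ord // eqxx andbT.
by apply/'forall_implyP => g gG; rewrite cG.
Qed.

Lemma coinvariants_deg0_neq0 : exists d, coinvariants_deg_neq0 d.
Proof.
exists 0%N; apply/asboolP; exists 1; first exact: dhomog1.
by rewrite pi_coinvariants_eq0; case: hilbert_ideal_closed.
Qed.

Lemma coinvariants_deg_bound d : coinvariants_deg_neq0 d -> (d <= n * #|G|)%N.
Proof.
case/asboolP=> f /dhomogP fd; apply: contraNT; rewrite -ltnNge => ltd.
rewrite pi_coinvariants_eq0 (mpolyE f) big_seq.
apply: gen_ideal_sum => m /fd /= mE.
rewrite -mul_mpolyC; apply: gen_idealMl.
have [i lei] : exists i, (#|G| <= m i)%N.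
  apply/existsP; apply: contraLR ltd => /existsPn H; rewrite -leqNgt -mE mdegE.
  rewrite -[n in leqRHS]card_ord -sum_nat_const leq_sum // => i _.
  by rewrite ltnW // ltnNge.
have /submK <- : (U_(i) *+ #|G| <= m)%MM.
  apply/mnm_lepP => j; rewrite mulmnE mnm1E.
  by case: eqP => [<-|_]; rewrite ?mul1n ?mul0n.
by rewrite mpolyXD -mpolyXn; apply/gen_idealMl/exp_var_hilbert_ideal.
Qed.

Definition topdeg_coinvariants : nat :=
  ex_maxn coinvariants_deg0_neq0 coinvariants_deg_bound.

End Coinvariants.

Arguments invariant {F gT G} V _.
Arguments invariant_pos {F gT G} V _.
Arguments hilbert_ideal {F gT G} V _.
Arguments coinvariants_deg_neq0 {F gT G} V _.
Arguments coinvariants_deg0_neq0 {F gT G} V.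

(* Main.v *)
Require Import Defs.
From HB Require Import structures.
From mathcomp Require Import all_boot all_order all_fingroup all_algebra.
From mathcomp Require Import mxrepresentation character.
From mathcomp Require Import mpoly.

Set Implicit Arguments.
Unset Strict Implicit.
Unset Printing Implicit Defensive.

Import Order.TTheory GRing.Theory.
Local Open Scope ring_scope.

(** Write S for the sum of the a_i - 1. Both top degrees equal S.

    The lower bound is a look at lead terms: the monomial with exponents a_i - 1
    has degree S and is its own lead term, and no x_i ^ a_i divides it, so it is
    not in I_A ([coinvariants_deg_lower]). Moreover F[V]_G is a graded quotient
    of F[V^m]_G, by restricting functions to one summand
    ([coinvariants_deg_copies]). It remains to show that every monomial of
    degree greater than S in the variables of V^m lies in the Hilbert ideal of
    V^m; call x_(i, j) the i-th variable of the j-th copy, and x_(i, 1), ...,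
    x_(i, m) the i-th block.

    Hilbert ideals are homogeneous, so for each i the hypothesis gives an
    element x_i ^ c + h of I_A with c <= a_i and h a combination of monomials of
    degree c that come after x_i ^ c ([hilbert_pure_lead]). Pulled back to one
    copy it is an element of the Hilbert ideal of V^m, and this ideal is stable
    under the polarization operators, the sums over i of
    x_(i, j) * d/dx_(i, k), because these are derivations that commute with G
    ([polarize_hilbert]). Each operator trades one variable for another one of
    the same block, so it preserves the vector of degrees in the n blocks.
    Applied repeatedly to the pulled-back element, with non-zero factors at each
    step because c < p, the operators reach, for every monomial M of degree c in
    the i-th block, an element M + h' of the Hilbert ideal in which the block
    degrees of the monomials of h' are those of monomials of h
    ([hilbert_block_lead]).

    A monomial of degree greater than S has degree at least a_i in some block i,
    hence a factor M as above, and replacing M by -h' lowers its block degree in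
    the monomial order and keeps its degree. This cannot go on for ever, so the
    monomial is 0 modulo the Hilbert ideal ([mpolyX_hilbert]). *)

(** * Polynomials: induction, support, substitution of linear forms *)

Lemma mpoly_ring_ind (R : comNzRingType) n (P : {mpoly R[n]} -> Prop) :
    (forall c, P c%:MP) -> (forall i, P 'X_i) ->
    (forall f g, P f -> P g -> P (f + g)) ->
    (forall f g, P f -> P g -> P (f * g)) ->
  forall f, P f.
Proof.
move=> PC PX PD PM f; rewrite (mpolyE f).
have P1 : P 1 by rewrite -mpolyC1.
apply: (big_ind P) => [||m _]; [by rewrite -mpolyC0 | exact: PD |].
rewrite -mul_mpolyC; apply: (PM) => //; rewrite mpolyXE_id.
apply: (big_ind P) => // i _.
by elim: (m i) => [|k IHk]; rewrite ?expr0 // exprS; apply: PM.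
Qed.

Section Support.
Variables (F : fieldType) (n : nat).
Implicit Types (f g : {mpoly F[n]}) (P : 'X_{1..n} -> Prop).

Definition supported P f := forall m, m \in msupp f -> P m.

Lemma supported0 P : supported P 0.
Proof. by move=> m; rewrite -mpolyC0 msupp0. Qed.

Lemma supportedD P f g : supported P f -> supported P g -> supported P (f + g).
Proof.
by move=> fP gP m /msuppD_le; rewrite mem_cat => /orP[/fP | /gP].
Qed.

Lemma supportedZ P c f : supported P f -> supported P (c *: f).
Proof. by move=> fP m /msuppZ_le/fP. Qed.

Lemma supportedX P m : P m -> supported P 'X_[m].
Proof. by move=> Pm m' /mem_msuppXP <-. Qed.

Lemma supported_sum P I (r : seq I) (Q : pred I) (h : I -> {mpoly F[n]}) :
  (forall i, Q i -> supported P (h i)) -> supported P (\sum_(i <- r | Q i) h i).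
Proof.
by move=> hP; apply: big_ind => //; [exact: supported0 | exact: supportedD].
Qed.

Lemma mcoeffMX_le f l k : (f * 'X_[l])@_k != 0 -> (l <= k)%MM.
Proof.
rewrite -mcoeff_msupp (perm_mem (msuppMX f l)) => /mapP[m _ ->].
exact: lem_addr.
Qed.

Lemma mcoeff_pihomog d f m :
  (pihomog mdeg d f)@_m = if mdeg m == d then f@_m else 0.
Proof.
rewrite pihomogE raddf_sum /= {3}(mpolyE f) raddf_sum /= big_mkcond /=.
case: ifP => md; last first.
  rewrite big1 // => k _; case: ifP => // kd; rewrite mcoeffZ mcoeffX.
  by case: (k =P m) kd md => [-> -> // | _ _ _]; rewrite mulr0.
apply: eq_bigr => k _; case: ifP => // kd; rewrite mcoeffZ mcoeffX.
by case: (k =P m) kd md => [-> -> // | _ _ _]; rewrite mulr0.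
Qed.

Lemma pihomogXM d m f : pihomog mdeg d ('X_[m] * f) =
  if (mdeg m <= d)%N then 'X_[m] * pihomog mdeg (d - mdeg m) f else 0.
Proof.
rewrite {1}(mpolyE f) mulr_sumr raddf_sum /=; case: leqP => md; last first.
  apply: big1 => k _; rewrite -scalerAr linearZ /= -mpolyXD pihomogX /= mdegD.
  by rewrite gtn_eqF ?scaler0 // ltn_addr.
rewrite [in RHS](mpolyE f) [pihomog _ (d - _) _]raddf_sum mulr_sumr.
apply: eq_bigr => k _; rewrite -scalerAr -mpolyXD /= !linearZ /=.
rewrite -scalerAr !pihomogX /= mdegD.
rewrite -[d in LHS](subnKC md) eqn_add2l.
by case: eqP => _; rewrite ?mulr0 ?mpolyXD.
Qed.

End Support.

Section LinearSubstitution.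
Variables (F : fieldType) (n k : nat) (t : n.-tuple {mpoly F[k]}).
Hypothesis t_lin : forall i, tnth t i \is 1.-homog for mdeg.

Lemma comp_mpolyX_dhomog m : ('X_[m] \mPo t) \is (mdeg m).-homog for mdeg.
Proof.
rewrite comp_mpolyX mdegE.
elim/big_rec2: _ => [|i d f _ fd]; first exact: dhomog1.
by apply: dhomogM => //; have:= dhomogMn (m i) (t_lin i); rewrite mul1n.
Qed.

Lemma comp_mpoly_dhomog d f :
  f \is d.-homog for mdeg -> (f \mPo t) \is d.-homog for mdeg.
Proof.
move/dhomogP=> fd; rewrite comp_mpolyEX big_seq rpred_sum // => m /fd /= <-.
by apply: rpredZ; apply: comp_mpolyX_dhomog.
Qed.

Lemma pihomog_comp d f :
  pihomog mdeg d (f \mPo t) = pihomog mdeg d f \mPo t.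
Proof.
elim/mpolyind: f => [|c m f _ _ IHf]; first by rewrite !raddf0.
rewrite !raddfD /= IHf; congr (_ + _); rewrite !linearZ /= pihomogX.
congr (_ *: _).
have mt := comp_mpolyX_dhomog m; case: eqP => [md | /eqP md].
  by rewrite pihomog_dE // -md.
by rewrite raddf0; apply: pihomog_ne0 mt.
Qed.

Lemma mcoeff0_comp f : (f \mPo t)@_0%MM = f@_0%MM.
Proof.
rewrite {2}(mpolyE f) comp_mpolyEX !raddf_sum /=; apply: eq_bigr => m _.
rewrite !mcoeffZ mcoeffX; congr (_ * _).
have [-> | m0] := eqVneq m 0%MM.
  by rewrite mpolyX0 comp_mpoly1 mcoeff1 !eqxx.
rewrite (dhomog_nemf_coeff (comp_mpolyX_dhomog m)) ?(negbTE m0) //=.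
by rewrite mdeg0 eq_sym mdeg_eq0.
Qed.

End LinearSubstitution.

(** * Maps that preserve Hilbert ideals *)

Section HilbertIdeal.
Variables (F : fieldType) (gT : finGroupType) (G : {group gT}).
Implicit Types V W : representation F G.

Local Notation act V g f := (@poly_act F gT G V g f).

Lemma invariantP V f :
  reflect (forall g, g \in G -> act V g f = f) (f \in Defs.invariant V).
Proof.
by apply: (iffP forall_inP) => fG g gG; [apply/eqP; exact: fG | rewrite fG].
Qed.

Lemma poly_actXU V g i :
  act V g 'X_i = \sum_(j < rdegree V) V g^-1%g i j *: 'X_j.
Proof. by rewrite /poly_act comp_mpolyXU -tnth_nth tnth_mktuple. Qed.

Lemma poly_act_lin V g i :
  tnth [tuple \sum_(j < rdegree V) V g^-1%g i j *: ('X_j : {mpoly F[rdegree V]})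
       | i < rdegree V] i \is 1.-homog for mdeg.
Proof.
by rewrite tnth_mktuple rpred_sum // => j _; rewrite rpredZ // dhomogX /= mdeg1.
Qed.

Lemma hilbert_ideal_img V W
    (E : {additive {mpoly F[rdegree V]} -> {mpoly F[rdegree W]}}) :
    (forall u v, v \in invariant_pos V -> E (u * v) \in hilbert_ideal W) ->
  forall f, f \in hilbert_ideal V -> E f \in hilbert_ideal W.
Proof.
move=> EM _ /gen_idealP[s [sS ->]]; rewrite raddf_sum big_seq.
by apply: gen_ideal_sum => u /sS/EM.
Qed.

Lemma hilbert_idealZ V c f :
  f \in hilbert_ideal V -> c *: f \in hilbert_ideal V.
Proof. by rewrite -mul_mpolyC; apply: gen_idealMl. Qed.

(** The group acts by linear substitutions, hence preserves degrees, and so the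
    homogeneous components of an invariant are invariant. *)
Lemma pihomog_hilbert V d f :
  f \in hilbert_ideal V -> pihomog mdeg d f \in hilbert_ideal V.
Proof.
apply: hilbert_ideal_img f => u v /andP[/invariantP vG /eqP v0].
rewrite (mpolyE u) mulr_suml raddf_sum; apply: gen_ideal_sum => m _ /=.
rewrite -scalerAl linearZ /=; apply: hilbert_idealZ; rewrite pihomogXM.
case: ifP => _; last exact: gen_ideal0.
apply/gen_idealMl/mem_gen_ideal/andP; split; last first.
  by rewrite mcoeff_pihomog v0 if_same.
apply/invariantP => g gG; rewrite -[in RHS](vG g gG); symmetry.
exact: pihomog_comp (@poly_act_lin V g) _ _.
Qed.

Lemma comp_hilbert V W (t : (rdegree V).-tuple {mpoly F[rdegree W]}) :
    (forall i, tnth t i \is 1.-homog for mdeg) ->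
    (forall g, g \in G -> forall i,
       act V g 'X_i \mPo t = act W g (tnth t i)) ->
  forall f, f \in hilbert_ideal V -> f \mPo t \in hilbert_ideal W.
Proof.
move=> t_lin tG; apply: (@hilbert_ideal_img V W (comp_mpoly t)) => u v.
case/andP=> /invariantP vG /eqP v0 /=; rewrite rmorphM.
apply/gen_idealMl/mem_gen_ideal/andP; split; last first.
  by rewrite mcoeff0_comp // v0.
apply/invariantP => g gG; rewrite -[in RHS](vG g gG).
elim/mpoly_ring_ind: v {vG v0} => [c | i | f h IHf IHh | f h IHf IHh].
- by rewrite /= /poly_act !comp_mpolyC.
- by rewrite /= tG // comp_mpolyXU -tnth_nth.
- by rewrite /= !raddfD /= IHf IHh.
by rewrite /= !rmorphM /= IHf IHh.
Qed.

(** By the product rule, an equivariant derivation maps u * v with v invariant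
    into the ideal generated by v and its image, which is again invariant. *)
Lemma derivation_hilbert W
    (D : {linear {mpoly F[rdegree W]} -> {mpoly F[rdegree W]}}) :
    (forall f h : {mpoly F[rdegree W]}, D (f * h) = D f * h + f * D h) ->
    (forall i, D 'X_i \is 1.-homog for mdeg) ->
    (forall g, g \in G -> forall i,
       D (act W g 'X_i) = act W g (D 'X_i)) ->
  forall f, f \in hilbert_ideal W -> D f \in hilbert_ideal W.
Proof.
move=> DM D_lin DG; have D1 : D 1 = 0.
  apply: (addrI (D 1)).
  by rewrite addr0 -[RHS](congr1 D (mulr1 1)) DM mulr1 mul1r.
have DC c : D c%:MP = 0 by rewrite -alg_mpolyC linearZ /= D1 scaler0.
apply: hilbert_ideal_img => u v vI; rewrite /= DM.
have /andP[/invariantP vG /eqP v0] := vI.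
apply: gen_idealD; apply: gen_idealMl; apply: mem_gen_ideal => //.
apply/andP; split; last first.
  apply/eqP; elim/mpoly_ring_ind: v {vI vG v0} => [c|i|f h f0 h0|f h f0 h0].
  - by rewrite DC mcoeff0.
  - by rewrite (dhomog_nemf_coeff (D_lin i)) //= mdeg0.
  - by rewrite !raddfD /= f0 h0 addr0.
  by rewrite DM raddfD /= !(rmorphM (mcoeff 0%MM)) /= f0 h0 mul0r mulr0 addr0.
apply/invariantP => g gG; rewrite -[in RHS](vG g gG); symmetry.
elim/mpoly_ring_ind: v {vI vG v0} => [c | i | f h IHf IHh | f h IHf IHh].
- by rewrite DC raddf0 /poly_act comp_mpolyC DC.
- exact: DG.
- by rewrite /= !raddfD /= IHf IHh.
by rewrite rmorphM !DM raddfD /= !rmorphM /= IHf IHh.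
Qed.

End HilbertIdeal.

(** * Block degree and polarization operators *)

Section BlockDegree.
Variables (n m N : nat) (pos : 'I_n * 'I_m -> 'I_N).
Hypothesis pos_bij : bijective pos.
Implicit Types (M : 'X_{1..N}) (b : 'X_{1..n}).

Definition block_degree M : 'X_{1..n} :=
  [multinom (\sum_(j < m) M (pos (i, j)))%N | i < n].

Lemma pos_eq u v : (pos u == pos v) = (u == v).
Proof. exact/inj_eq/bij_inj. Qed.

Lemma block_degreeD M1 M2 :
  block_degree (M1 + M2) = (block_degree M1 + block_degree M2)%MM.
Proof.
apply/mnmP => i; rewrite mnmDE !mnmE -big_split /=.
by apply: eq_bigr => j _; rewrite mnmDE.
Qed.

Lemma block_degree1 i j : block_degree U_(pos (i, j))%MM = U_(i)%MM.
Proof.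
apply/mnmP => k; rewrite mnmE mnm1E (bigD1 j) //= mnm1E pos_eq xpair_eqE eqxx.
rewrite andbT big1 ?addn0 // => l lj.
by rewrite mnm1E pos_eq xpair_eqE [j == l]eq_sym (negbTE lj) andbF.
Qed.

Lemma block_degree_sum (r : seq 'I_n) (e : 'I_n -> nat) j :
  block_degree (\sum_(i <- r) U_(pos (i, j)) *+ e i)%MM =
  (\sum_(i <- r) U_(i) *+ e i)%MM.
Proof.
have bd0 : block_degree 0%MM = 0%MM.
  by apply/mnmP => i; rewrite mnmE mnm0E big1 // => k _; rewrite mnm0E.
rewrite (big_morph block_degree block_degreeD bd0); apply: eq_bigr => i _.
elim: (e i) => [|k IHk]; first by rewrite !mulm0n.
by rewrite !mulmS block_degreeD block_degree1 IHk.
Qed.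

Lemma mdeg_block M : mdeg (block_degree M) = mdeg M.
Proof.
rewrite !mdegE (reindex pos) /=; last exact: onW_bij.
rewrite (eq_bigr (fun i => \sum_(j < m) M (pos (i, j)))%N) => [|i _].
  by rewrite pair_big /=; apply: eq_bigr => -[].
by rewrite mnmE.
Qed.

Lemma leq_block_degree M i j : (M (pos (i, j)) <= block_degree M i)%N.
Proof. by rewrite mnmE (bigD1 j) //= leq_addr. Qed.

Lemma block_submonomial M i c : (c <= block_degree M i)%N ->
  exists2 M1, (M1 <= M)%MM & block_degree M1 = (U_(i) *+ c)%MM.
Proof.
elim: c => [_ | c IHc lt_cM].
  exists 0%MM; first by apply/mnm_lepP => k; rewrite mnm0E.
  by apply/mnmP => k; rewrite mulm0n mnmE mnm0E big1 // => j _; rewrite mnm0E.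
have [M1 leM1 bM1] := IHc (ltnW lt_cM).
have : (0 < block_degree (M - M1) i)%N.
  have := lt_cM; rewrite -{1}(submK leM1) block_degreeD mnmDE bM1 mulmnE mnm1E.
  by rewrite eqxx mul1n -[X in (X < _)%N]add0n ltn_add2r.
rewrite lt0n mnmE sum_nat_eq0 => /forallPn[j /=]; rewrite -lep1mP => leU.
exists (U_(pos (i, j)) + M1)%MM.
  apply/mnm_lepP => k; rewrite mnmDE -(submK leM1) mnmDE leq_add2r.
  exact: (mnm_lepP leU).
by rewrite block_degreeD block_degree1 bM1 mulmS.
Qed.

(** At equal degree the order on 'X_{1..n} is lexicographic, so these are the
    monomials allowed next to a lead monomial x_i ^ c. Applied to block degrees,
    the same condition describes what they become under polarization. *)
Definition below i c b := mdeg b = c /\ (b < (U_(i) *+ c)%MM)%O.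

Variable F : fieldType.
Implicit Types f : {mpoly F[N]}.

Definition polarize j k f : {mpoly F[N]} :=
  \sum_(i < n) 'X_(pos (i, j)) * f^`M(pos (i, k)).

Lemma polarize_is_linear j k : linear (polarize j k).
Proof.
move=> c f h; rewrite /polarize scaler_sumr -big_split; apply: eq_bigr => i _.
by rewrite /= mderivD mderivZ mulrDr -scalerAr.
Qed.

HB.instance Definition _ j k :=
  GRing.isLinear.Build F {mpoly F[N]} {mpoly F[N]} _ (polarize j k)
    (@polarize_is_linear j k).

Lemma polarizeM j k f h :
  polarize j k (f * h) = polarize j k f * h + f * polarize j k h.
Proof.
rewrite /polarize mulr_suml mulr_sumr -big_split; apply: eq_bigr => i _ /=.
by rewrite mderivM mulrDr !mulrA [f * _]mulrC.
Qed.

Lemma polarizeX j k M : polarize j k 'X_[M] =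
  \sum_(i < n) (M (pos (i, k)))%:R *:
    'X_[M - U_(pos (i, k)) + U_(pos (i, j))].
Proof.
apply: eq_bigr => i _.
by rewrite mderivX -scalerAr -mpolyXD addmC.
Qed.

Lemma polarizeXU j k i l : polarize j k 'X_(pos (i, l)) =
  if l == k then 'X_(pos (i, j)) else 0.
Proof.
rewrite /polarize (bigD1 i) //= big1 => [|i' i'i].
  rewrite addr0 mderivX mnm1E pos_eq xpair_eqE eqxx /=.
  case: eqP => [->|_]; last by rewrite scale0r mulr0.
  by rewrite scale1r -[X in (X - _)%MM]add0m addmK mpolyX0 mulr1.
rewrite mderivX mnm1E pos_eq xpair_eqE [i == i']eq_sym (negbTE i'i).
by rewrite scale0r mulr0.
Qed.

(** Each term of the operator replaces one variable by another variable of the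
    same block. *)
Lemma polarize_block (P : 'X_{1..n} -> Prop) j k f :
    supported (fun M => P (block_degree M)) f ->
  supported (fun M => P (block_degree M)) (polarize j k f).
Proof.
move=> fP; rewrite (mpolyE f) raddf_sum big_seq.
apply: supported_sum => M /fP PM; rewrite /= linearZ /=.
apply: supportedZ; rewrite polarizeX.
apply: supported_sum => i _; case: (posnP (M (pos (i, k)))) => [-> | M_gt0].
  by rewrite scale0r; apply: supported0.
have leM : (U_(pos (i, k)) <= M)%MM by rewrite lep1mP -lt0n.
apply: supportedZ; apply: supportedX.
by move: PM; rewrite -{1}(submK leM) !block_degreeD !block_degree1.
Qed.

Lemma polarize_pure j k i c M : block_degree M = (U_(i) *+ c)%MM ->
  polarize j k 'X_[M] = (M (pos (i, k)))%:R *: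
    'X_[M - U_(pos (i, k)) + U_(pos (i, j))].
Proof.
move=> bM; rewrite polarizeX (bigD1 i) //= big1 ?addr0 // => i' i'i.
have := leq_block_degree M i' k; rewrite bM mulmnE mnm1E eq_sym (negbTE i'i).
by rewrite leqn0 => /eqP ->; rewrite scale0r.
Qed.

End BlockDegree.

(** * Direct sums of copies of a representation *)

Section Copies.
Variables (F : fieldType) (gT : finGroupType) (G : {group gT}).
Variable V : representation F G.
Local Notation n := (rdegree V).
Local Notation act V g f := (@poly_act F gT G V g f).

(** The coordinates of an iterated direct sum are nested blocks; a bijection
    that sends (i, j) to the position of the i-th coordinate of the j-th summand
    hides the nesting. *)
Definition copies m (W : representation F G)
    (pos : 'I_n * 'I_m -> 'I_(rdegree W)) :=
  bijective pos /\
  forall g u v, W g (pos u) (pos v) = V g u.1 v.1 *+ (u.2 == v.2).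

Lemma muln_copies m : exists pos, @copies m (muln_grepr V m) pos.
Proof.
elim: m => [|m [pos [pos_bij posE]]].
  have no0 (u : 'I_n * 'I_0) : False by case: u => _ [].
  exists (fun u => False_rect _ (no0 u)); split=> [|g u]; last by case: (no0 u).
  suff h (x : 'I_(rdegree (muln_grepr V 0))) : 'I_n * 'I_0.
    by exists h => [u | x]; [case: (no0 u) | case: (no0 (h x))].
  by move: x; rewrite /muln_grepr big_ord0 => -[].
rewrite /muln_grepr big_ord_recl -/(muln_grepr V m).
pose p (u : 'I_n * 'I_m.+1) : 'I_(n + rdegree (muln_grepr V m)) :=
  if unlift ord0 u.2 is Some j then rshift n (pos (u.1, j)) else lshift _ u.1.
have [q posK qK] := pos_bij.
pose r (x : 'I_(n + rdegree (muln_grepr V m))) : 'I_n * 'I_m.+1 :=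
  match split x with
  | inl i => (i, ord0) | inr y => ((q y).1, lift ord0 (q y).2) end.
exists p; split=> [|g [i j] [i' j']].
  exists r => [[i j] | x]; rewrite /p /r /=.
    case: unliftP => [j' -> | ->]; first by rewrite (unsplitK (inr _)) posK.
    by rewrite (unsplitK (inl _)).
  case: splitP => y xy; apply: val_inj; first by rewrite /= unlift_none.
  by rewrite /= liftK -surjective_pairing qK.
rewrite /p /=; case: unliftP => [k -> | ->]; case: unliftP => [k' -> | ->].
- by rewrite block_mxEdr posE /= (inj_eq lift_inj).
- by rewrite block_mxEdl mxE.
- by rewrite block_mxEur mxE.
by rewrite block_mxEul eqxx.
Qed.

Variables (m : nat) (W : representation F G).
Variable pos : 'I_n * 'I_m -> 'I_(rdegree W).
Hypothesis posW : copies pos.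
Local Notation A := {mpoly F[n]}.
Local Notation B := {mpoly F[rdegree W]}.

Let pos_bij : bijective pos. Proof. by have [] := posW. Qed.

Lemma poly_act_pos g i j :
  act W g 'X_(pos (i, j)) = \sum_(k < n) V g^-1%g i k *: 'X_(pos (k, j)).
Proof.
rewrite poly_actXU (reindex pos) /=; last exact: onW_bij.
pose h k l : B := if l == j then V g^-1%g i k *: 'X_(pos (k, l)) else 0.
rewrite (eq_bigr (fun u => h u.1 u.2)) => [|[k l] _]; last first.
  have [_ ->] := posW; rewrite /h /= eq_sym.
  by case: eqP => _; rewrite ?mulr1n // scale0r.
rewrite -(pair_bigA _ h); apply: eq_bigr => k _.
by rewrite /h -big_mkcond big_pred1_eq.
Qed.

Definition copy_vars j := [tuple ('X_(pos (i, j)) : B) | i < n].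

Lemma copy_vars_lin j i : tnth (copy_vars j) i \is 1.-homog for mdeg.
Proof. by rewrite tnth_mktuple dhomogX /= mdeg1. Qed.

Lemma copy_vars_hilbert j f :
  f \in hilbert_ideal V -> f \mPo copy_vars j \in hilbert_ideal W.
Proof.
apply: comp_hilbert f => [i | g _ i]; first exact: copy_vars_lin.
rewrite tnth_mktuple poly_act_pos poly_actXU raddf_sum; apply: eq_bigr => k _.
by rewrite /= comp_mpolyZ comp_mpolyXU -tnth_nth tnth_mktuple.
Qed.

(** Restricting functions from V^m to the j-th summand undoes their pullback
    along the j-th projection, so F[V]_G is a graded quotient of F[V^m]_G. *)
Lemma coinvariants_deg_copies (j : 'I_m) d :
  coinvariants_deg_neq0 V d -> coinvariants_deg_neq0 W d.
Proof.
case/boolp.asboolP=> f fd; rewrite pi_coinvariants_eq0 => fI.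
apply/boolp.asboolP; exists (f \mPo copy_vars j).
  exact (comp_mpoly_dhomog (copy_vars_lin j) fd).
rewrite pi_coinvariants_eq0; apply: contra fI => fI.
have [q posK qK] := pos_bij.
pose r : (rdegree W).-tuple A :=
  [tuple if (q x).2 == j then 'X_(q x).1 else 0 | x < rdegree W].
have rE i l : tnth r (pos (i, l)) = if l == j then 'X_i else 0.
  by rewrite tnth_mktuple posK.
have -> : f = (f \mPo copy_vars j) \mPo r.
  elim/mpoly_ring_ind: f {fd fI} => [c | i | f h IHf IHh | f h IHf IHh].
  - by rewrite !comp_mpolyC.
  - rewrite comp_mpolyXU -tnth_nth tnth_mktuple comp_mpolyXU -tnth_nth.
    by rewrite rE eqxx.
  - by rewrite !raddfD /= -IHf -IHh.
  by rewrite !rmorphM /= -IHf -IHh.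
apply: comp_hilbert fI => [x | g _ x]; rewrite -(qK x); case: (q x) => i l.
  by rewrite rE; case: eqP => _; rewrite ?dhomog0 // dhomogX /= mdeg1.
rewrite rE poly_act_pos raddf_sum /=.
rewrite (eq_bigr (fun k => if l == j then V g^-1%g i k *: 'X_k else 0)).
  case: eqP => _; first by rewrite poly_actXU.
  by rewrite big1_eq [RHS]raddf0.
move=> k _; rewrite comp_mpolyZ comp_mpolyXU -tnth_nth rE.
by case: eqP => _; rewrite ?scaler0.
Qed.

(** Polarization moves the coordinates of one copy onto those of another by the
    identity of V, which commutes with G. *)
Lemma polarize_hilbert j k f :
  f \in hilbert_ideal W -> polarize pos j k f \in hilbert_ideal W.
Proof.
have [q posK qK] := pos_bij.
apply: (@derivation_hilbert F gT G W (polarize pos j k)) f => [f h | x | g _ x].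
- exact: polarizeM.
- rewrite /= -(qK x); case: (q x) => i l; rewrite polarizeXU //.
  by case: eqP => _; rewrite ?dhomog0 // dhomogX /= mdeg1.
rewrite -(qK x); case: (q x) => i l; rewrite poly_act_pos raddf_sum /=.
rewrite polarizeXU //.
rewrite (eq_bigr (fun a =>
  if l == k then V g^-1%g i a *: 'X_(pos (a, j)) else 0)).
  case: eqP => _; first by rewrite poly_act_pos.
  by rewrite big1_eq [RHS]raddf0.
move=> a _; rewrite linearZ /= polarizeXU //.
by case: eqP => _; rewrite ?scaler0.
Qed.

End Copies.

(** * Lead terms and the top degree *)

(** The order carried by 'X_{1..n} compares degrees first, so it agrees with the
    lexicographic order on monomials of equal degree. *)
Lemma lexlead_max (F : fieldType) n (f : {mpoly F[n]}) M :
  M \in msupp f -> mdeg M = mdeg (lexlead f) -> (M <= lexlead f)%O.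
Proof.
move=> fM dM; rewrite leEmnm dM lexi_cons lexx /=.
exact: (@joins_sup_seq _ (n.-tuplelexi nat) _ _ xpredT
  (fun M => multinom_val M) M).
Qed.

Section TopDegree.
Variables (F : fieldType) (gT : finGroupType) (G : {group gT}).
Variables (V : representation F G) (a : 'I_(rdegree V) -> nat).
Local Notation n := (rdegree V).
Hypothesis lead_hilbert :
  lead_term_ideal (hilbert_ideal V) =i pure_power_ideal a.

(** A power of x_i in the lead term ideal is a multiple of the lead term of some
    f in the Hilbert ideal, which is then itself a power of x_i; the homogeneous
    component of f in that degree has the same lead term. *)
Lemma hilbert_pure_lead i : exists c h,
  [/\ (c <= a i)%N, supported (below i c) h
    & 'X_i ^+ c + h \in hilbert_ideal V].
Proof.
have : ('X_i : {mpoly F[n]}) ^+ a i \in pure_power_ideal a.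
  by apply: mem_gen_ideal; apply/existsP; exists i.
rewrite -lead_hilbert => /gen_idealP[s [sS /(congr1 (mcoeff (U_(i) *+ a i)))]].
rewrite mpolyXn mcoeffX eqxx raddf_sum /= => E.
have [/hasP[u us nz]|/hasPn z] :=
    boolP (has (fun u => (u.1 * u.2)@_(U_(i) *+ a i) != 0) s); last first.
  move/eqP: E; rewrite big_seq big1 ?oner_eq0 // => u /z; rewrite negbK.
  by move/eqP.
have /boolp.asboolP[f [fI _ uE]] := sS u us; pose l := lexlead f.
move: nz; rewrite uE /lead_term -/l -scalerAr mcoeffZ mulf_eq0 negb_or.
case/andP=> fl /mcoeffMX_le/mnm_lepP le_l.
have lE : l = (U_(i) *+ l i)%MM.
  apply/mnmP => k; have := le_l k; rewrite !mulmnE !mnm1E.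
  by case: eqP => [<-|_]; rewrite ?mul1n // mul0n leqn0 => /eqP.
exists (l i), ((f@_l)^-1 *: pihomog mdeg (l i) f - 'X_[l]); split.
- by have := le_l i; rewrite mulmnE mnm1E eqxx mul1n.
- move=> M; rewrite mcoeff_msupp mcoeffB mcoeffZ mcoeffX mcoeff_pihomog.
  have dl : mdeg l = l i by rewrite {1}lE mdegMn mdeg1 mul1n.
  have [<- | lM] := eqVneq l M; first by rewrite dl eqxx mulVf // subrr eqxx.
  case: (mdeg M =P l i) => [dM | _]; last by rewrite mulr0 subr0 eqxx.
  rewrite subr0 mulf_eq0 negb_or -mcoeff_msupp => /andP[_ fM].
  split=> //; rewrite -lE lt_neqAle eq_sym lM /=.
  by apply: lexlead_max; rewrite // dM -dl.
by rewrite mpolyXn -lE addrC subrK; apply/hilbert_idealZ/pihomog_hilbert.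
Qed.

(** An exponent 0 would put a non-zero constant into the Hilbert ideal. *)
Lemma exponent_gt0 i : (0 < a i)%N.
Proof.
have [[|c] [h [ca hb hI]]] := hilbert_pure_lead i; last exact: leq_ltn_trans ca.
have h0 : h = 0.
  apply/mpolyP => M; rewrite mcoeff0; apply/eqP; rewrite mcoeff_eq0.
  apply/negP => /hb[dM]; rewrite mulm0n.
  by have /eqP := dM; rewrite mdeg_eq0 => /eqP ->; rewrite ltxx.
by have [_ /negP[]] := hilbert_ideal_closed V; rewrite -[1]addr0 -h0.
Qed.

(** A monomial is its own lead term, so if it lies in I_A, then some
    x_i ^ a_i divides it. *)
Lemma coinvariants_deg_lower :
  coinvariants_deg_neq0 V (\sum_(i < n) (a i).-1).
Proof.
pose M := [multinom (a i).-1 | i < n]; apply/boolp.asboolP; exists 'X_[M].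
  by rewrite dhomogX /= mdegE; apply/eqP/eq_bigr => i _; rewrite mnmE.
rewrite pi_coinvariants_eq0; apply/negP => MI.
have : 'X_[M] \in lead_term_ideal (hilbert_ideal V).
  apply: mem_gen_ideal; apply/boolp.asboolP; exists 'X_[M]; split=> //.
    apply/eqP => /(congr1 (mcoeff M))/eqP.
    by rewrite mcoeffX eqxx mcoeff0 oner_eq0.
  have E : lexlead ('X_[M] : {mpoly F[n]}) = M.
    by rewrite /lexlead msuppX big_seq1; apply: val_inj.
  by rewrite /lead_term E mcoeffX eqxx scale1r.
rewrite lead_hilbert => /gen_idealP[s [sS /(congr1 (mcoeff M))/eqP]].
rewrite mcoeffX eqxx raddf_sum big_seq big1 ?oner_eq0 //= => u /sS.
case/existsP=> i /eqP ->; rewrite mpolyXn; apply/eqP/negPn/negP.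
move/mcoeffMX_le/mnm_lepP/(_ i); rewrite mulmnE mnm1E eqxx mul1n mnmE.
by rewrite leqNgt prednK ?leqnn // exponent_gt0.
Qed.

Hypothesis a_lt_char : forall p : nat, p \in [pchar F] -> forall i, (a i < p)%N.

Lemma natr_exponent_neq0 i c : (0 < c <= a i)%N -> c%:R != 0 :> F.
Proof.
case/andP=> c_gt0 ca; rewrite natf_neq0_pchar; apply/pnatP => // p p_pr pc.
by apply/negP => /a_lt_char/(_ i); rewrite ltnNge (leq_trans (dvdn_leq _ pc)).
Qed.

Variables (m : nat) (W : representation F G).
Variable pos : 'I_n * 'I_m -> 'I_(rdegree W).
Hypothesis posW : copies pos.
Variable j0 : 'I_m.

Let pos_bij : bijective pos. Proof. by have [] := posW. Qed.

(** Polarization reaches every monomial of degree c in the i-th block from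
    x_(i, j0) ^ c, by moving one factor at a time out of the copy j0. Each move
    multiplies by the exponent of x_(i, j0), which is at most a i. *)
Lemma hilbert_block_lead i : exists2 c, (c <= a i)%N &
  forall M, block_degree pos M = (U_(i) *+ c)%MM ->
  exists2 h, supported (fun M' => below i c (block_degree pos M')) h &
    'X_[M] + h \in hilbert_ideal W.
Proof.
have [c [f [ca fb fI]]] := hilbert_pure_lead i; exists c => // M bM.
(* s is the number of factors of M outside the copy j0. *)
have [s] : exists s, (M (pos (i, j0)) + s)%N = c.
  exists (c - M (pos (i, j0)))%N; apply: subnKC.
  by have := leq_block_degree pos M i j0; rewrite bM mulmnE mnm1E eqxx mul1n.
elim: s M bM => [|s IHs] M bM Ms.
  have dM : mdeg M = c by rewrite -(mdeg_block pos_bij) bM mdegMn mdeg1 mul1n.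
  have leM : (U_(pos (i, j0)) *+ c <= M)%MM.
    apply/mnm_lepP => x; rewrite mulmnE mnm1E -Ms addn0.
    by case: eqP => [<-|_]; rewrite ?mul1n.
  have -> : M = (U_(pos (i, j0)) *+ c)%MM.
    have := congr1 mdeg (submK leM); rewrite mdegD mdegMn mdeg1 mul1n dM.
    move/eqP; rewrite -[X in _ == X]add0n eqn_add2r mdeg_eq0 => /eqP E.
    by rewrite -(submK leM) E add0m.
  exists (f \mPo copy_vars pos j0); last first.
    have := copy_vars_hilbert posW j0 fI; rewrite rmorphD rmorphXn /=.
    by rewrite comp_mpolyXU -tnth_nth tnth_mktuple mpolyXn.
  rewrite comp_mpolyEX big_seq; apply: supported_sum => M' /fb M'b.
  apply: supportedZ; rewrite comp_mpolyX.
  under eq_bigr => k _ do rewrite tnth_mktuple.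
  rewrite mprodXnE; apply: supportedX.
  by rewrite block_degree_sum // -multinomUE_id.
have [j j'j0 Mj] : exists2 j, j != j0 & (0 < M (pos (i, j)))%N.
  apply/exists_inP; apply: contraLR isT => /exists_inPn H.
  have /mnmP/(_ i) := bM; rewrite mnmE mulmnE mnm1E eqxx mul1n (bigD1 j0) //=.
  rewrite big1 => [|j /H]; last by rewrite -eqn0Ngt => /eqP.
  by move=> E; move/eqP: Ms; rewrite -E eqn_add2l.
have leM : (U_(pos (i, j)) <= M)%MM by rewrite lep1mP -lt0n.
(* M arises from M' by moving one factor from the copy j0 to the copy j. *)
pose M' := (M - U_(pos (i, j)) + U_(pos (i, j0)))%MM.
have bM' : block_degree pos M' = (U_(i) *+ c)%MM.
  by rewrite -bM -[in RHS](submK leM) !block_degreeD !block_degree1.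
have M'j0 : M' (pos (i, j0)) = (M (pos (i, j0))).+1.
  rewrite mnmDE mnmBE !mnm1E !(pos_eq pos_bij) !xpair_eqE (negbTE j'j0) !eqxx.
  by rewrite subn0 addn1.
have [|h hb hI] := IHs M' bM'; first by rewrite M'j0 addSnnS.
have k0 : (M' (pos (i, j0)))%:R != 0 :> F.
  apply: (@natr_exponent_neq0 i); rewrite {1}M'j0 /= (leq_trans _ ca) //.
  by rewrite -Ms M'j0 addnS ltnS leq_addr.
exists ((M' (pos (i, j0)))%:R^-1 *: polarize pos j j0 h).
  apply: supportedZ.
  exact: (polarize_block pos_bij (P := below i c)).
have := hilbert_idealZ (M' (pos (i, j0)))%:R^-1 (polarize_hilbert posW j j0 hI).
rewrite raddfD /= (polarize_pure F j j0 bM') addmK submK // scalerDr scalerA.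
by rewrite mulVf // scale1r.
Qed.

(** Splitting off a factor of block degree U_(i) *+ c and replacing it modulo
    the Hilbert ideal moves the block degree down in the monomial order without
    changing the degree, so the rewriting ends; it ends at 0 because every
    monomial on the way has degree greater than that sum, hence degree at least
    a i in some block. *)
Lemma mpolyX_hilbert M :
  (\sum_(i < n) (a i).-1 < mdeg M)%N -> 'X_[M] \in hilbert_ideal W.
Proof.
have [b bM] : exists b, block_degree pos M = b by exists (block_degree pos M).
elim/(well_founded_ind (@ltom_wf n)): b M bM => b IHb M bM ltM.
have [i lt_aM] : exists i, (a i <= block_degree pos M i)%N.
  apply/existsP; apply: contraLR ltM => /existsPn H; rewrite -leqNgt.
  rewrite -(mdeg_block pos_bij) mdegE leq_sum // => i _.
  by rewrite -ltnS prednK ?exponent_gt0 // ltnNge.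
have [c ca lead_c] := hilbert_block_lead i.
have [M1 leM1 bM1] := block_submonomial pos_bij (leq_trans ca lt_aM).
have [h hb hI] := lead_c M1 bM1.
have -> : 'X_[M] = 'X_[M - M1] * ('X_[M1] + h) - 'X_[M - M1] * h.
  by rewrite mulrDr addrK -mpolyXD submK.
rewrite -mulrN; apply: gen_idealD; first exact: gen_idealMl.
rewrite -scaleN1r -scalerAr; apply: hilbert_idealZ.
rewrite (mpolyE h) mulr_sumr big_seq; apply: gen_ideal_sum => M' /hb[dM' ltM'].
rewrite -scalerAr -mpolyXD; apply: hilbert_idealZ.
have dMM : mdeg (M - M1 + M')%MM = mdeg M.
  have dM1 : mdeg M1 = c.
    by rewrite -(mdeg_block pos_bij) bM1 mdegMn mdeg1 mul1n.
  by rewrite -[in RHS](submK leM1) !mdegD dM1 -(mdeg_block pos_bij M') dM'.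
apply: (IHb (block_degree pos (M - M1 + M'))) => //; last by rewrite dMM.
by rewrite -bM -[in X in (_ < X)%O](submK leM1) !block_degreeD bM1 ltmc_add2r.
Qed.

Lemma coinvariants_deg_upper d :
  coinvariants_deg_neq0 W d -> (d <= \sum_(i < n) (a i).-1)%N.
Proof.
case/boolp.asboolP=> f /dhomogP fd; apply: contraNT; rewrite -ltnNge => ltd.
rewrite pi_coinvariants_eq0 (mpolyE f) big_seq.
apply: gen_ideal_sum => M /fd /= dM; apply: hilbert_idealZ.
by apply: mpolyX_hilbert; rewrite dM.
Qed.

End TopDegree.

Lemma topdeg_coinvariantsE (F : fieldType) (gT : finGroupType) (G : {group gT})
    (V : representation F G) d :
    coinvariants_deg_neq0 V d ->
    (forall e, coinvariants_deg_neq0 V e -> (e <= d)%N) ->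
  topdeg_coinvariants V = d.
Proof.
move=> Vd dmax; rewrite /topdeg_coinvariants; case: ex_maxnP => e Ve emax.
by apply/eqP; rewrite eqn_leq dmax // emax.
Qed.

Theorem theorem13 (F : fieldType) (gT : finGroupType) (G : {group gT})
    (V : representation F G) (a : 'I_(rdegree V) -> nat)
    (a_lt_char : forall p : nat, p \in [pchar F] -> forall i, (a i < p)%N)
    (lead_hilbert : lead_term_ideal (hilbert_ideal V) =i pure_power_ideal a)
    (m : nat) (m_gt0 : (0 < m)%N) :
  topdeg_coinvariants (muln_grepr V m) = topdeg_coinvariants V /\
  (topdeg_coinvariants V)%:Z = \sum_(i < rdegree V) ((a i)%:Z - 1).
Proof.
have [pos posW] := muln_copies V m; pose j0 := Ordinal m_gt0.
have lowV := coinvariants_deg_lower lead_hilbert.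
have upW := coinvariants_deg_upper lead_hilbert a_lt_char posW j0.
have V_to_W := coinvariants_deg_copies posW j0.
have topV := topdeg_coinvariantsE lowV (fun e Ve => upW e (V_to_W e Ve)).
rewrite (topdeg_coinvariantsE (V_to_W _ lowV) upW) topV; split=> //.
rewrite -natz natr_sum; apply: eq_bigr => i _.
by rewrite natz -subn1 -subzn // (exponent_gt0 lead_hilbert).
Qed.
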